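(* Let $X$ be a biquandle. If $Y$ is a constant action biquandle, then the Hom-biquandle $\mathbf{Hom}_B(X,Y)$ is a constant action biquandle.
   Context: A biquandle is a set $X$ with two binary operations $\underline{\ast},\overline{\ast}$ such that: (i) $x\,\underline{\ast}\,x=x\,\overline{\ast}\,x$ for all $x$; (ii) for every $y$ the maps $x\mapsto x\,\underline{\ast}\,y$ and $x\mapsto x\,\overline{\ast}\,y$ are bijections of $X$, and $S(x,y)=(y\,\overline{\ast}\,x,\;x\,\underline{\ast}\,y)$ is a bijection of $X\times X$; (iii) for all $x,y,z$: $(x\underline{\ast}y)\underline{\ast}(z\underline{\ast}y)=(x\underline{\ast}z)\underline{\ast}(y\overline{\ast}z)$, $(x\underline{\ast}y)\overline{\ast}(z\underline{\ast}y)=(x\overline{\ast}z)\underline{\ast}(y\overline{\ast}z)$, $(x\overline{\ast}y)\overline{\ast}(z\overline{\ast}y)=(x\overline{\ast}z)\overline{\ast}(y\underline{\ast}z)$. A biquandle homomorphism is a map preserving both operations; $\mathrm{Hom}_B(X,Y)$ is the set of biquandle homomorphisms $X\to Y$. A biquandle $Y$ is a constant action biquandle if there is a bijection $\sigma\colon Y\to Y$ with $x\,\underline{\ast}\,y=x\,\overline{\ast}\,y=\sigma(x)$ for all $x,y\in Y$. A biquandle is medial if $(x\underline{\ast}y)\underline{\ast}(z\underline{\ast}w)=(x\underline{\ast}z)\underline{\ast}(y\underline{\ast}w)$, $(x\underline{\ast}y)\overline{\ast}(z\underline{\ast}w)=(x\overline{\ast}z)\underline{\ast}(y\overline{\ast}w)$,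 $(x\overline{\ast}y)\overline{\ast}(z\overline{\ast}w)=(x\overline{\ast}z)\overline{\ast}(y\overline{\ast}w)$ for all $x,y,z,w$; every constant action biquandle is medial. If $Y$ is medial, $\mathrm{Hom}_B(X,Y)$ with pointwise operations $(f\underline{\ast}g)(x)=f(x)\underline{\ast}g(x)$, $(f\overline{\ast}g)(x)=f(x)\overline{\ast}g(x)$ is a medial biquandle (known), called the Hom-biquandle $\mathbf{Hom}_B(X,Y)$. *)

(* Defs.v *)
From mathcomp Require Import all_boot.
From mathcomp Require Import boolp.

Set Implicit Arguments.
Unset Strict Implicit.
Unset Printing Implicit Defensive.

Reserved Notation "x *_ y" (at level 40, left associativity).
Reserved Notation "x *^ y" (at level 40, left associativity).

(* [under x y], written [x *_ y], is the underlined operation of the biquandle;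
   [over x y], written [x *^ y], is the overlined one. *)
Record biquandle := Biquandle {
  bq_sort :> Type;
  under : bq_sort -> bq_sort -> bq_sort;
  over : bq_sort -> bq_sort -> bq_sort;
  under_over_diag : forall x, under x x = over x x;
  under_bij : forall y, bijective (fun x => under x y);
  over_bij : forall y, bijective (fun x => over x y);
  switch_bij :
    bijective (fun p : bq_sort * bq_sort => (over p.2 p.1, under p.1 p.2));
  exchange_uu : forall x y z,
    under (under x y) (under z y) = under (under x z) (over y z);
  exchange_uo : forall x y z,
    over (under x y) (under z y) = under (over x z) (over y z);
  exchange_oo : forall x y z,
    over (over x y) (over z y) = over (over x z) (under y z)
}.

Arguments under {b} x y : rename.
Arguments over {b} x y : rename.

Notation "x *_ y" := (under x y).
Notation "x *^ y" := (over x y).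

Definition constant_action (Y : biquandle) : Prop :=
  exists2 sigma : Y -> Y, bijective sigma &
    forall x y : Y, x *_ y = sigma x /\ x *^ y = sigma x.

Definition medial (Y : biquandle) : Prop :=
  [/\ forall x y z w : Y, (x *_ y) *_ (z *_ w) = (x *_ z) *_ (y *_ w),
      forall x y z w : Y, (x *_ y) *^ (z *_ w) = (x *^ z) *_ (y *^ w) &
      forall x y z w : Y, (x *^ y) *^ (z *^ w) = (x *^ z) *^ (y *^ w)].

Lemma constant_action_medial (Y : biquandle) : constant_action Y -> medial Y.
Proof.
case=> s _ sE; have uE x y : x *_ y = s x := (sE x y).1.
have oE x y : x *^ y = s x := (sE x y).2.
by split=> x y z w; rewrite !(uE, oE).
Qed.

Record bq_hom (X Y : biquandle) := BqHom {
  bq_hom_fun :> X -> Y;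
  hom_under : forall a b, bq_hom_fun (a *_ b) = bq_hom_fun a *_ bq_hom_fun b;
  hom_over : forall a b, bq_hom_fun (a *^ b) = bq_hom_fun a *^ bq_hom_fun b
}.

Section HomBiquandle.
Variables (X Y : biquandle) (mY : medial Y).
Implicit Types f g h : bq_hom X Y.

Lemma bq_hom_eq f g : (forall a, f a = g a) -> f = g.
Proof.
case: f g => [f fu fo] [g gu go] /= /funext efg; rewrite efg in fu fo *.
by congr BqHom; exact: Prop_irrelevance.
Qed.

Fact hom_und_under f g a b :
  f (a *_ b) *_ g (a *_ b) = (f a *_ g a) *_ (f b *_ g b).
Proof. by case: mY => uu _ _; rewrite !hom_under uu. Qed.

Fact hom_und_over f g a b :
  f (a *^ b) *_ g (a *^ b) = (f a *_ g a) *^ (f b *_ g b).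
Proof. by case: mY => _ uo _; rewrite !hom_over uo. Qed.

Fact hom_ove_under f g a b :
  f (a *_ b) *^ g (a *_ b) = (f a *^ g a) *_ (f b *^ g b).
Proof. by case: mY => _ uo _; rewrite !hom_under uo. Qed.

Fact hom_ove_over f g a b :
  f (a *^ b) *^ g (a *^ b) = (f a *^ g a) *^ (f b *^ g b).
Proof. by case: mY => _ _ oo; rewrite !hom_over oo. Qed.

Definition homU f g : bq_hom X Y :=
  BqHom (hom_und_under f g) (hom_und_over f g).
Definition homO f g : bq_hom X Y :=
  BqHom (hom_ove_under f g) (hom_ove_over f g).

Fact inj_surj_bijective (A B : Type) (F : A -> B) :
  injective F -> (forall b, exists a, F a = b) -> bijective F.
Proof.
move=> injF /choice[G GK]; exists G => // a; exact/injF/GK.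
Qed.

Fact homU_diag f : homU f f = homO f f.
Proof. by apply: bq_hom_eq => a /=; exact: under_over_diag. Qed.

Fact homU_bij g : bijective (fun f => homU f g).
Proof.
have [uu uo oo] := mY.
apply: inj_surj_bijective => [f f' eff'|h].
  apply: bq_hom_eq => a; apply: (bij_inj (under_bij (g a))).
  exact: (congr1 (fun k : bq_hom X Y => k a) eff').
have /choice[f fE] a : exists y, y *_ g a = h a.
  by have [k _ kK] := under_bij (g a); exists (k (h a)).
have fu a b : f (a *_ b) = f a *_ f b.
  apply: (bij_inj (under_bij (g (a *_ b)))).
  by rewrite /= fE !hom_under uu !fE.
have fo a b : f (a *^ b) = f a *^ f b.
  apply: (bij_inj (under_bij (g (a *^ b)))).
  by rewrite /= fE !hom_over -uo !fE.
by exists (BqHom fu fo); exact: bq_hom_eq.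
Qed.

Fact homO_bij g : bijective (fun f => homO f g).
Proof.
have [uu uo oo] := mY.
apply: inj_surj_bijective => [f f' eff'|h].
  apply: bq_hom_eq => a; apply: (bij_inj (over_bij (g a))).
  exact: (congr1 (fun k : bq_hom X Y => k a) eff').
have /choice[f fE] a : exists y, y *^ g a = h a.
  by have [k _ kK] := over_bij (g a); exists (k (h a)).
have fu a b : f (a *_ b) = f a *_ f b.
  apply: (bij_inj (over_bij (g (a *_ b)))).
  by rewrite /= fE !hom_under uo !fE.
have fo a b : f (a *^ b) = f a *^ f b.
  apply: (bij_inj (over_bij (g (a *^ b)))).
  by rewrite /= fE !hom_over oo !fE.
by exists (BqHom fu fo); exact: bq_hom_eq.
Qed.

Fact hom_switch_bij :
  bijective (fun p : bq_hom X Y * bq_hom X Y => (homO p.2 p.1, homU p.1 p.2)).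
Proof.
have [uu uo oo] := mY; have injS := bij_inj (switch_bij Y).
apply: inj_surj_bijective => [[f g] [f' g'] /= [eo eu]|[h k]].
  have efg a : (f a, g a) = (f' a, g' a).
    by apply: injS => /=; rewrite (congr1 (@^~ a) eo) (congr1 (@^~ a) eu).
  by congr pair; apply: bq_hom_eq => a; case: (efg a).
have /choice[p pE] a : exists q : Y * Y,
    (q.2 *^ q.1, q.1 *_ q.2) = (h a, k a).
  by have [T _ TK] := switch_bij Y; exists (T (h a, k a)); exact: TK.
have pO a : (p a).2 *^ (p a).1 = h a := congr1 fst (pE a).
have pU a : (p a).1 *_ (p a).2 = k a := congr1 snd (pE a).
have pu a b : p (a *_ b) = ((p a).1 *_ (p b).1, (p a).2 *_ (p b).2).
  by apply: injS; rewrite /= pO pU uo uu !pO !pU !hom_under.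
have po a b : p (a *^ b) = ((p a).1 *^ (p b).1, (p a).2 *^ (p b).2).
  by apply: injS; rewrite /= pO pU oo -uo !pO !pU !hom_over.
have p1u a b : (p (a *_ b)).1 = (p a).1 *_ (p b).1 by rewrite pu.
have p1o a b : (p (a *^ b)).1 = (p a).1 *^ (p b).1 by rewrite po.
have p2u a b : (p (a *_ b)).2 = (p a).2 *_ (p b).2 by rewrite pu.
have p2o a b : (p (a *^ b)).2 = (p a).2 *^ (p b).2 by rewrite po.
exists (@BqHom X Y (fun a => (p a).1) p1u p1o,
        @BqHom X Y (fun a => (p a).2) p2u p2o).
by congr pair; apply: bq_hom_eq => a /=.
Qed.

Fact hom_exchange_uu f g h :
  homU (homU f g) (homU h g) = homU (homU f h) (homO g h).
Proof. by apply: bq_hom_eq => a /=; exact: exchange_uu. Qed.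

Fact hom_exchange_uo f g h :
  homO (homU f g) (homU h g) = homU (homO f h) (homO g h).
Proof. by apply: bq_hom_eq => a /=; exact: exchange_uo. Qed.

Fact hom_exchange_oo f g h :
  homO (homO f g) (homO h g) = homO (homO f h) (homU g h).
Proof. by apply: bq_hom_eq => a /=; exact: exchange_oo. Qed.

Definition hom_biquandle : biquandle :=
  Biquandle homU_diag homU_bij homO_bij hom_switch_bij
    hom_exchange_uu hom_exchange_uo hom_exchange_oo.

End HomBiquandle.

Arguments hom_biquandle X {Y} mY.

(* Main.v *)
From mathcomp Require Import all_boot.
Require Import Defs.

(** Being constant action amounts to identities: the operations agree and ignore their second
    argument. Identities of [Y] pass to pointwise operations on homomorphisms; bijectivity of the
    action then comes from the biquandle axiom on translations. *)

(* The map [x |-> x *_ x] serves as the constant action: choosing it avoids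
   picking a base point, which need not exist as [B] may be empty. *)
Lemma constant_action_of_independence (B : biquandle) :
    (forall x y z : B, x *_ y = x *_ z) ->
    (forall x y : B, x *^ y = x *_ y) ->
  constant_action B.
Proof.
move=> uE oE; exists (fun x => x *_ x) => [|x y]; last first.
  by rewrite oE; split; exact: uE.
apply: inj_surj_bijective => [x y exy|y].
  (* By [uE] the squaring map agrees with translation by any element, here [x]; below, by [y]. *)
  by apply: (bij_inj (under_bij x)); rewrite exy; exact: uE.
have [k _ kK] := under_bij y.
by exists (k y); rewrite -[RHS](kK y); exact: uE.
Qed.

Theorem proposition5p8 (X Y : biquandle) (cY : constant_action Y) :
  constant_action (hom_biquandle X (constant_action_medial cY)).
Proof.
have [s _ sE] := cY.
have uE x y : x *_ y = s x := (sE x y).1.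
have oE x y : x *^ y = s x := (sE x y).2.
(* At each [a], both operations send [f], [g] to [s (f a)], whatever [g] is. *)
by apply: constant_action_of_independence => [f g h|f g];
  apply: bq_hom_eq => a /=; rewrite ?oE !uE.
Qed.
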